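(* Let $d \ge 1$ and $m \ge 0$, and let $\ell_1,\dots,\ell_m \in H_1(\mathbb{C}^2)$ be fixed, pairwise non-proportional linear forms. Let $r \ge 0$ and let $e_1,\dots,e_r$ be positive integers with $e_k \mid d$ for each $k$ and $d > e_1 \ge e_2 \ge \cdots \ge e_r$. Suppose further that $$m + \sum_{k=1}^r (e_k+1) = d+1.$$ Then a general binary form $p \in H_d(\mathbb{C}^2)$ can be written as $$p(x,y) = \sum_{j=1}^m t_j\,\ell_j(x,y)^d + \sum_{k=1}^r f_k(x,y)^{d/e_k},$$ with $t_j \in \mathbb{C}$ and $f_k \in H_{e_k}(\mathbb{C}^2)$.
   Context: $H_d(\mathbb{C}^n)$ denotes the complex vector space of homogeneous polynomials of degree $d$ in $n$ variables. ''A general $p$ has property P'' means P holds for all $p$ in a nonempty Zariski-open subset of $H_d(\mathbb{C}^n)$. *)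

(* Defs.v *)
From HB Require Import structures.
From mathcomp Require Import all_boot all_order all_algebra.
Set Implicit Arguments. Unset Strict Implicit. Unset Printing Implicit Defensive.
Import Order.TTheory GRing.Theory Num.Theory.
Local Open Scope ring_scope.

(* Bivariate polynomials in x (outer variable) and y (inner variable):
   the coefficient (P`_i)`_j is the coefficient of x^i y^j. *)
Notation bipoly R := {poly {poly R}}.

Definition homog {R : nzRingType} (e : nat) (P : bipoly R) : Prop :=
  forall i j : nat, (P`_i)`_j != 0 -> (i + j)%N = e.

Definition coords {R : nzRingType} (d : nat) (P : bipoly R) : seq R :=
  mkseq (fun i => (P`_i)`_(d - i)) d.+1.

(* Zariski-open subsets of R^n (points given as sequences of size n):
   complement of the common zero set of finitely many polynomials, here
   given as inverse-free ring terms in the variables 'X_0, ..., 'X_(n-1). *)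
Definition zopen {R : unitRingType} (n : nat) (U : seq R -> Prop) : Prop :=
  exists ts : seq (GRing.term R),
    all (@GRing.rterm R) ts /\
    forall x : seq R, size x = n ->
      (U x <-> has (fun t => GRing.eval x t != 0) ts).

Definition general_form {R : unitRingType} (d : nat) (Q : bipoly R -> Prop) : Prop :=
  exists U : seq R -> Prop,
    [/\ zopen d.+1 U,
        (exists x : seq R, size x = d.+1 /\ U x) &
        forall p : bipoly R, homog d p -> U (coords d p) -> Q p].

(* Main.v *)
Require Import Defs.
From HB Require Import structures.
From mathcomp Require Import all_boot all_order all_algebra.
From mathcomp Require Import closed_field.
From Stdlib Require Import Classical.
Import Order.TTheory GRing.Theory Num.Theory.
Local Open Scope ring_scope.

(* Parametrize by the t_j and the coefficients of the f_k: the source has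
   dimension m + sum (e_k + 1) = d + 1, that of the space of forms.  At t = 0,
   f_k = L_k^(e_k), the differential has image spanned by the l_j^d and the
   L_k^(d - e_k) H_(e_k).  By apolarity a functional killing this space is a
   form of degree d vanishing at the points l_j and to order e_k + 1 at the
   points L_k, so it is zero as soon as all these points are distinct: the
   differential is onto.  Hence no nonzero polynomial vanishes on the image, and
   this constructible set contains a nonempty open set. *)

(** * Polynomial identities and density along curves *)

Lemma poly_fun_eq0 (R : numFieldType) (p : {poly R}) :
  (forall a, p.[a] = 0) -> p = 0.
Proof.
(* In characteristic 0 the naturals below [size p] are distinct: too many roots for a nonzero
   [p]. *)
move=> p0; apply: (@roots_geq_poly_eq0 _ p [seq i%:R | i <- iota 0 (size p)]).
- by apply/allP=> x _; rewrite rootE p0.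
- by rewrite map_inj_uniq ?iota_uniq // => i j /eqP; rewrite eqr_nat => /eqP.
- by rewrite size_map size_iota.
Qed.

Lemma horner_horner (R : comNzRingType) (p : {poly {poly R}}) (q : {poly R}) a :
  p.[q].[a] = p.[(q.[a])%:P].[a].
Proof.
rewrite !(horner_coef p) !horner_sum; apply: eq_bigr => i _.
by rewrite !hornerM !horner_exp hornerC.
Qed.

(** Ring terms contain no inverses, so substituting a two-parameter polynomial family gives a
    polynomial in both parameters. The outer variable of [g] takes the value [a], the inner one
    [b]. *)
Lemma eval_along_bipoly (R : comUnitRingType) n (t : GRing.term R)
    (e : nat -> bipoly R) :
  GRing.rterm t ->
  exists g : bipoly R, forall a b,
    g.[a%:P].[b] = GRing.eval (mkseq (fun i => (e i).[a%:P].[b]) n) t.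
Proof.
elim: t => //=.
- move=> i _; exists (if (i < n)%N then e i else 0) => a b.
  case: ltnP => hi; first by rewrite nth_mkseq.
  by rewrite nth_default ?size_mkseq // !horner0.
- by move=> x _; exists (x%:P%:P) => a b; rewrite !hornerC.
- by move=> k _; exists (k%:R) => a b; rewrite -!polyC_natr !hornerC.
- move=> t1 IH1 t2 IH2 /andP[/IH1[g1 g1E] /IH2[g2 g2E]].
  by exists (g1 + g2) => a b; rewrite !hornerD g1E g2E.
- by move=> t IH /IH[g gE]; exists (- g) => a b; rewrite !hornerN gE.
- by move=> t IH k /IH[g gE]; exists (g *+ k) => a b; rewrite !hornerMn gE.
- move=> t1 IH1 t2 IH2 /andP[/IH1[g1 g1E] /IH2[g2 g2E]].
  by exists (g1 * g2) => a b; rewrite !hornerM g1E g2E.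
- by move=> t IH k /IH[g gE]; exists (g ^+ k) => a b; rewrite !horner_exp gE.
Qed.

(* The hypothesis says that the set S contains, through the point y0, polynomial
   curves with arbitrary tangent vectors.  Writing phi(t) = y0 + t u(t) for such
   a curve and h(s,t) = G(y0 + s u(t)), one has h(t,t) = 0; if all the
   coefficients of s^j, j < k, vanish, dividing by t^k shows that the
   coefficient of s^k in G(y0 + s w) vanishes too. *)
Lemma zariski_dense_of_curves (R : numFieldType) n (S : seq R -> Prop)
    (y0 : nat -> R) :
  (forall w : nat -> R, exists phi : nat -> {poly R},
    [/\ forall i, (i < n)%N -> (phi i)`_0 = y0 i,
        forall i, (i < n)%N -> (phi i)`_1 = w i &
        forall a, S (mkseq (fun i => (phi i).[a]) n)]) ->
  forall G : GRing.term R, GRing.rterm G ->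
  (forall x, S x -> GRing.eval x G = 0) ->
  forall x, size x = n -> GRing.eval x G = 0.
Proof.
move=> curves G rG GS.
(* All directions [w] are treated at once: the step for [k] uses smaller indices in the directions
   u(b). *)
have key k : forall (w : nat -> R) (g : {poly R}),
    (forall s, g.[s] = GRing.eval (mkseq (fun i => y0 i + s * w i) n) G) ->
    g`_k = 0.
  elim/ltn_ind: k => k IH w g gE.
  have [phi [phi0 phi1 phiS]] := curves w.
  pose u i := drop_poly 1 (phi i).
  have phiE i : (i < n)%N -> phi i = (y0 i)%:P + u i * 'X.
    move=> lt_in; rewrite -[LHS](poly_take_drop 1) expr1; congr (_ + _).
    by apply/polyP => -[|j]; rewrite coef_take_poly coefC //= phi0.
  (* In [h] the outer variable is s and the inner one t; [h.['X]] is thus the restriction to the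
     diagonal s = t. *)
  have [h hE] :=
    @eval_along_bipoly R n G (fun i => (y0 i)%:P%:P + (u i)%:P * 'X) rG.
  have {}hE a b : h.[a%:P].[b] =
      GRing.eval (mkseq (fun i => y0 i + a * (u i).[b]) n) G.
    rewrite hE; congr GRing.eval; apply: eq_mkseq => i.
    by rewrite !hornerE [RHS]addrC addrC mulrC.
  have hX : h.['X] = 0.
    apply: poly_fun_eq0 => a; rewrite horner_horner hornerX hE -(GS _ (phiS a)).
    congr GRing.eval; apply/eq_in_map => i; rewrite mem_iota /= => lt_in.
    by rewrite phiE // !hornerE mulrC.
  have hmap b s : (map_poly (horner_eval b) h).[s] = h.[s%:P].[b].
    by rewrite -[s in LHS](hornerC s b) -/(horner_eval b _) horner_map.
  have hlow j : (j < k)%N -> h`_j = 0.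
    move=> lt_jk; apply: poly_fun_eq0 => b.
    have := IH j lt_jk (fun i => (u i).[b]) (map_poly (horner_eval b) h).
    by rewrite coef_map; apply=> s; rewrite hmap hE.
  (* Since u(0) = w, setting t = 0 in [h] recovers [g]. *)
  have gh : g = map_poly (horner_eval 0) h.
    apply/eqP; rewrite -subr_eq0; apply/eqP/poly_fun_eq0 => s.
    rewrite hornerD hornerN hmap gE hE; apply/eqP; rewrite subr_eq0; apply/eqP.
    congr GRing.eval; apply/eq_in_map => i; rewrite mem_iota /= => lt_in.
    by rewrite -phi1 // horner_coef0 coef_drop_poly.
  have hdrop : h = drop_poly k h * 'X^k.
    rewrite -[LHS](poly_take_drop k) (_ : take_poly k h = 0) ?add0r //.
    apply/polyP => j; rewrite coef_take_poly coef0.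
    by case: ifP => // /hlow.
  have /eqP : (drop_poly k h).['X] * 'X^k = 0.
    by rewrite -hX [in RHS]hdrop hornerM hornerXn.
  (* Cancel t^k on the diagonal, then put t = 0: only the coefficient of s^k at t = 0 remains. *)
  rewrite mulf_eq0 expf_eq0 polyX_eq0 andbF orbF => /eqP /(congr1 (horner^~ 0)).
  rewrite /= horner_horner hornerX polyC0 (horner_coef0 (drop_poly _ _)) coef_drop_poly.
  rewrite add0n horner0.
  by rewrite gh coef_map.
(* Any [x] lies at s = 1 on the line y0 + s (x - y0), along which [G] has only zero coefficients. *)
move=> x sx; pose w i := x`_i - y0 i.
have [h hE] :=
  @eval_along_bipoly R n G (fun i => (y0 i)%:P%:P + (w i)%:P%:P * 'X) rG.
have gE s : (map_poly (horner_eval 0) h).[s] =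
    GRing.eval (mkseq (fun i => y0 i + s * w i) n) G.
  rewrite -[s in LHS](hornerC s 0) -/(horner_eval 0 _) horner_map /= /horner_eval hE.
  congr GRing.eval; apply: eq_mkseq => i.
  by rewrite !hornerE mulrC.
have /polyP g0 : forall k, (map_poly (horner_eval 0) h)`_k = (0 : {poly R})`_k.
  by move=> k; rewrite coef0 (key k w).
have := gE 1; rewrite g0 horner0 => ->; congr GRing.eval.
rewrite -{1}(mkseq_nth 0 x) sx; apply: eq_mkseq => i.
by rewrite mul1r /w addrC subrK.
Qed.

(** * Constructible sets *)

Definition dnf_sat {R : unitRingType} (x : seq R)
    (bc : seq (GRing.term R) * seq (GRing.term R)) :=
  all (fun t => GRing.eval x t == 0) bc.1
  && all (fun t => GRing.eval x t != 0) bc.2.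

Lemma qf_eval_dnf (R : fieldType) (x : seq R) bcs :
  GRing.qf_eval x (GRing.dnf_to_form bcs) = has (dnf_sat x) bcs.
Proof.
elim: bcs => //= -[E N] bcs -> /=; congr (_ || _); congr (_ && _).
  by elim: E => //= t E ->.
by elim: N => //= t N ->.
Qed.

Definition nonvanishing {R : unitRingType} n (t : GRing.term R) :=
  exists2 x, size x = n & GRing.eval x t != 0.

(** On the line through the two points of nonvanishing, both terms become nonzero univariate
    polynomials, and so does their product. *)
Lemma nonvanishingM (R : numFieldType) n (t1 t2 : GRing.term R) :
  GRing.rterm t1 -> GRing.rterm t2 -> nonvanishing n t1 ->
  nonvanishing n t2 -> nonvanishing n (GRing.Mul t1 t2).
Proof.
move=> r1 r2 [x1 s1 n1] [x2 s2 n2].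
pose e i : bipoly R := (x1`_i)%:P%:P + (x2`_i - x1`_i)%:P%:P * 'X.
have eE a b i : (e i).[a%:P].[b] = x1`_i + (x2`_i - x1`_i) * a.
  by rewrite /e !hornerE.
have [g1 g1E] := eval_along_bipoly R n t1 e r1.
have [g2 g2E] := eval_along_bipoly R n t2 e r2.
have e0 : mkseq (fun i => (e i).[0%:P].[0]) n = x1.
  by rewrite -[RHS](mkseq_nth 0) s1; apply: eq_mkseq => i; rewrite eE mulr0 addr0.
have e1 : mkseq (fun i => (e i).[1%:P].[0]) n = x2.
  rewrite -[RHS](mkseq_nth 0) s2; apply: eq_mkseq => i.
  by rewrite eE mulr1 addrC subrK.
pose p := map_poly (horner_eval 0) (g1 * g2).
have pE a : p.[a] = g1.[a%:P].[0] * g2.[a%:P].[0].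
  rewrite /p -[a in LHS](hornerC a 0) -/(horner_eval 0 _) horner_map /= /horner_eval.
  by rewrite !hornerM.
have [a pa] : exists a, p.[a] != 0.
  apply: NNPP => p0; suff: map_poly (horner_eval 0) g1 * map_poly (horner_eval 0) g2 == 0.
    rewrite mulf_eq0 => /orP[] /eqP.
      move=> /(congr1 (horner^~ (horner_eval 0 0%:P))) /=.
      rewrite horner_map /= /horner_eval hornerC g1E e0 horner0 => /eqP.
      by rewrite (negPf n1).
    move=> /(congr1 (horner^~ (horner_eval 0 1%:P))) /=.
    rewrite horner_map /= /horner_eval g2E e1 horner0 => /eqP.
    by rewrite (negPf n2).
  rewrite -rmorphM; apply/eqP/poly_fun_eq0 => a.
  by apply/eqP/negPn/negP => pa; apply: p0; exists a.
exists (mkseq (fun i => (e i).[a%:P].[0]) n); first by rewrite size_mkseq.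
by rewrite /= -g1E -g2E -pE.
Qed.

Definition contains_open {R : unitRingType} n (S : seq R -> Prop) :=
  exists U : seq R -> Prop,
    [/\ zopen n U, (exists x : seq R, size x = n /\ U x) &
        forall x, size x = n -> U x -> S x].

(** Let [P] be the product of the terms required to be nonzero. If [P] vanishes everywhere, the
    clause is empty and [G] is 1. If all equations hold identically, the clause is the open set
    where [P] is nonzero. Otherwise [G] is an equation that fails somewhere. *)
Lemma clause_dichotomy (R : numFieldType) n bc : GRing.dnf_rterm bc ->
  contains_open n (fun x => dnf_sat x bc) \/
  exists G : GRing.term R, [/\ GRing.rterm G, nonvanishing n G &
    forall x, size x = n -> dnf_sat x bc -> GRing.eval x G = 0].
Proof.
case: bc => E N /andP[/= rE rN].
pose P := foldr (@GRing.Mul R) (GRing.Const 1) N.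
have rP : GRing.rterm P.
  by rewrite /P; elim: N rN {P} => //= t N IH /andP[-> /IH].
have PE x : (GRing.eval x P != 0) = all (fun t => GRing.eval x t != 0) N.
  rewrite /P; elim: N {rN P rP} => [|t N IH] /=; first by rewrite oner_eq0.
  by rewrite mulf_eq0 negb_or IH.
have nv1 : nonvanishing n (GRing.Const (1 : R)).
  by exists (nseq n 0); rewrite ?size_nseq //= oner_eq0.
have [nvP|vP] := classic (nonvanishing n P); last first.
  right; exists (GRing.Const 1); split=> // x sx /andP[_ /=].
  by rewrite -PE => Px; case: vP; exists x.
have [E0|nE0] := classic (forall x, size x = n ->
  all (fun t => GRing.eval x t == 0) E).
  left; exists (fun x => GRing.eval x P != 0); split.
  - by exists [:: P]; rewrite /= rP; split=> // x _; rewrite orbF.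
  - by case: nvP => x sx Px; exists x.
  - by move=> x sx Px; rewrite /dnf_sat /= E0 // -PE.
right; have [x sx] : exists2 x, size x = n &
    has (fun t => GRing.eval x t != 0) E.
  apply: NNPP => nx; apply: nE0 => x sx; apply/negPn/negP; rewrite -has_predC.
  by move=> hx; apply: nx; exists x.
case/(has_nthP (GRing.Const 0)) => i lt_i Ei.
exists (nth (GRing.Const 0) E i); split; first exact: (all_nthP _ rE).
  by exists x.
by move=> z _ /andP[/= /all_nthP Ez _]; apply/eqP/Ez.
Qed.

(** One clause containing an open set is enough; if there is none, the product of the hypersurface
    equations of the clauses vanishes on the union. *)
Lemma dnf_dichotomy (R : numFieldType) n bcs : all GRing.dnf_rterm bcs ->
  contains_open n (fun x => has (dnf_sat x) bcs) \/
  exists G : GRing.term R, [/\ GRing.rterm G, nonvanishing n G &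
    forall x, size x = n -> has (dnf_sat x) bcs -> GRing.eval x G = 0].
Proof.
elim: bcs => [|bc bcs IH] /=.
  move=> _; right; exists (GRing.Const 1); split=> //.
  by exists (nseq n 0); rewrite ?size_nseq //= oner_eq0.
case/andP=> rbc /IH[[U [oU nU US]]|[G [rG nvG GS]]].
  by left; exists U; split=> // x sx /US->; rewrite ?orbT.
case: (clause_dichotomy _ n _ rbc) => [[U [oU nU US]]|[H [rH nvH HS]]].
  by left; exists U; split=> // x sx /US->.
right; exists (GRing.Mul G H); split; first by rewrite /= rG rH.
  exact: nonvanishingM.
by move=> x sx /= /orP[/HS->|/GS->]; rewrite ?mulr0 ?mul0r.
Qed.

(* By elimination of quantifiers the set defined by f is constructible, hence it
   contains a nonempty open set or lies in a proper hypersurface. *)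
Lemma definable_contains_open (R : numClosedFieldType) n (f : GRing.formula R) :
  GRing.rformula f ->
  (forall G : GRing.term R, GRing.rterm G ->
    (forall x, size x = n -> GRing.holds x f -> GRing.eval x G = 0) ->
    forall x, size x = n -> GRing.eval x G = 0) ->
  contains_open n (fun x => GRing.holds x f).
Proof.
move=> rf dense.
pose qe := GRing.quantifier_elim (@ClosedFieldQE.ex_elim R) f.
have wf := @GRing.quantifier_elim_wf R _ (@ClosedFieldQE.wf_ex_elim R) f rf.
have qeP x : reflect (GRing.holds x f)
    (has (dnf_sat x) (GRing.qf_to_dnf qe false)).
  rewrite -qf_eval_dnf GRing.qf_to_dnfP //.
  exact: (GRing.quantifier_elim_rformP (@ClosedFieldQE.wf_ex_elim R)
    (ClosedFieldQE.holds_ex_elim (@solve_monicpoly R))).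
have rqe : all GRing.dnf_rterm (GRing.qf_to_dnf qe false).
  by apply: GRing.qf_to_dnf_rterm; case/andP: wf.
case: (dnf_dichotomy _ n _ rqe) => [[U [oU nU US]]|[G [rG [x sx nG] GS]]].
  by exists U; split=> // x sx Ux; apply/qeP/US.
by case/eqP: nG; apply: dense => // z sz /qeP; apply: GS.
Qed.

(** * Polynomial functions of the parameters, given by ring terms *)

Definition ring_fun {R : unitRingType} (g : seq R -> R) :=
  exists2 t : GRing.term R, GRing.rterm t & forall z, GRing.eval z t = g z.

Definition bipoly_fun {R : unitRingType} (B : seq R -> bipoly R) :=
  forall i j, ring_fun (fun z => (B z)`_i`_j).

Section RingFun.
Variable R : unitRingType.
Implicit Types (g h : seq R -> R) (B C : seq R -> bipoly R).

Lemma eq_ring_fun g h : g =1 h -> ring_fun g -> ring_fun h.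
Proof. by move=> gh [t rt tE]; exists t => // z; rewrite tE gh. Qed.

Lemma ring_fun_const c : ring_fun (fun=> c : R).
Proof. by exists (GRing.Const c). Qed.

Lemma ring_fun_nth i : ring_fun (fun z : seq R => z`_i).
Proof. by exists (GRing.Var R i). Qed.

Lemma ring_funD g h : ring_fun g -> ring_fun h -> ring_fun (fun z => g z + h z).
Proof.
move=> [t rt tE] [u ru uE]; exists (GRing.Add t u) => /=; first by rewrite rt.
by move=> z; rewrite tE uE.
Qed.

Lemma ring_funM g h : ring_fun g -> ring_fun h -> ring_fun (fun z => g z * h z).
Proof.
move=> [t rt tE] [u ru uE]; exists (GRing.Mul t u) => /=; first by rewrite rt.
by move=> z; rewrite tE uE.
Qed.

Lemma ring_fun_sum (I : Type) (s : seq I) (g : I -> seq R -> R) :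
  (forall i, ring_fun (g i)) -> ring_fun (fun z => \sum_(i <- s) g i z).
Proof.
move=> gP; elim: s => [|i s IH].
  by apply: (eq_ring_fun (fun=> 0)) (ring_fun_const 0) => z; rewrite big_nil.
by apply: eq_ring_fun (ring_funD _ _ (gP i) IH) => z; rewrite big_cons.
Qed.

Lemma bipoly_fun_const P : bipoly_fun (fun=> P : bipoly R).
Proof. by move=> i j; apply: ring_fun_const. Qed.

Lemma bipoly_funC g : ring_fun g -> bipoly_fun (fun z => (g z)%:P%:P).
Proof.
move=> gP i j; apply: (eq_ring_fun
  (fun z => if (i == 0%N) && (j == 0%N) then g z else 0)).
  by move=> z; rewrite coefC; case: i => [|i]; rewrite ?coef0 ?coefC; case: j.
by case: (_ && _) => //; apply: ring_fun_const.
Qed.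

Lemma bipoly_funD B C :
  bipoly_fun B -> bipoly_fun C -> bipoly_fun (fun z => B z + C z).
Proof.
move=> BP CP i j; apply: eq_ring_fun (ring_funD _ _ (BP i j) (CP i j)) => z.
by rewrite !coefD.
Qed.

Lemma bipoly_funM B C :
  bipoly_fun B -> bipoly_fun C -> bipoly_fun (fun z => B z * C z).
Proof.
move=> BP CP i j.
apply: (eq_ring_fun (fun z => \sum_(a < i.+1) \sum_(b < j.+1)
    (B z)`_a`_b * (C z)`_(i - a)`_(j - b))) => [z|].
  by rewrite coefM coef_sum; apply: eq_bigr => a _; rewrite coefM.
by do 2 (apply: ring_fun_sum => ?); apply: ring_funM.
Qed.

Lemma bipoly_fun_exp B k : bipoly_fun B -> bipoly_fun (fun z => B z ^+ k).
Proof.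
move=> BP; elim: k => [|k IH]; first exact: bipoly_fun_const.
move=> i j; apply: eq_ring_fun (bipoly_funM _ _ BP IH i j) => z.
by rewrite exprS.
Qed.

Lemma bipoly_fun_sum (I : Type) (s : seq I) (B : I -> seq R -> bipoly R) :
  (forall i, bipoly_fun (B i)) -> bipoly_fun (fun z => \sum_(i <- s) B i z).
Proof.
move=> BP i j; apply: eq_ring_fun (ring_fun_sum _ s _ (fun k => BP k i j)) => z.
by rewrite !coef_sum.
Qed.
End RingFun.

(* The variables below n name a point of R^n, the next N ones a parameter. *)
Lemma image_formula (R : unitRingType) n N (g : nat -> seq R -> R) :
  (forall i, ring_fun (g i)) ->
  exists f : GRing.formula R, [/\ GRing.rformula f,
    forall x, GRing.holds x f ->
      exists z, forall i, (i < n)%N -> g i z = x`_i &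
    forall z, size z = (n + N)%N -> (forall i, (i < n)%N -> g i z = z`_i) ->
      GRing.holds (take n z) f].
Proof.
move=> gP.
have [c rc cP] : exists2 c : GRing.formula R, GRing.rformula c &
    forall z, GRing.holds z c <-> forall i, (i < n)%N -> g i z = z`_i.
  elim: {N} n => [|n [c rc cP]]; first by exists (GRing.Bool true).
  have [t rt tE] := gP n.
  exists (GRing.And c (GRing.Equal t (GRing.Var R n))) => /=.
    by rewrite rc rt.
  move=> z; rewrite tE; split=> [[/cP cz gn] i|gz].
    by rewrite ltnS leq_eqVlt => /orP[/eqP->|/cz].
  by split; [apply/cP => i lt_in; apply/gz/ltnW | apply: gz].
exists (foldr GRing.Exists c (iota n N)); split.
- by elim: (iota n N).
- move=> x /GRing.foldExistsP[z zx /cP cz]; exists z => i lt_in.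
  by rewrite zx ?cz // inE mem_iota leqNgt lt_in.
move=> z sz gz; apply/GRing.foldExistsP; exists z; last exact/cP.
move=> i; rewrite inE mem_iota negb_and -ltnNge -leqNgt => /orP[lt_in|le_i].
  by rewrite nth_take.
(* From index [n + N] on, both sequences return the default 0. *)
by rewrite !nth_default // ?sz // size_take sz; case: ifP => // _;
  apply: leq_trans le_i; rewrite leq_addr.
Qed.

(** * Binary forms *)

Section Forms.
Variable R : comNzRingType.
Implicit Types (P Q : bipoly R) (a : nat -> R).

Definition binform e a : bipoly R :=
  \sum_(i < e.+1) (a i)%:P%:P * ('X^i * 'Y ^+ (e - i)).

Lemma coef_monomial (i j k l : nat) :
  (('X^i * 'Y ^+ j : bipoly R)`_k)`_l = ((k == i) && (l == j))%:R.
Proof.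
rewrite -polyC_exp coefMC coefXn; case: eqP => _; last by rewrite mul0r coef0.
by rewrite mul1r coefXn.
Qed.

Lemma coef_scaleP (c : R) P i j : (c%:P%:P * P)`_i`_j = c * P`_i`_j.
Proof. by rewrite !coefCM. Qed.

Lemma coef_binform e a i j :
  (binform e a)`_i`_j = if (i + j == e)%N then a i else 0.
Proof.
rewrite /binform !coef_sum.
under eq_bigr => k _ do rewrite coef_scaleP coef_monomial.
case: eqP => [eq_e|ne_e].
  have lt_i : (i < e.+1)%N by rewrite ltnS -eq_e leq_addr.
  rewrite (bigD1 (Ordinal lt_i)) //= big1 => [|k nk].
    by rewrite eqxx -eq_e addKn eqxx mulr1 addr0.
  case: eqP => [ik|_]; rewrite ?mulr0 //; case/eqP: nk; exact: val_inj.
rewrite big1 // => k _; case: andP => [[/eqP ik /eqP jk]|_]; rewrite ?mulr0 //.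
by case: ne_e; rewrite ik jk subnKC // -ltnS.
Qed.

Lemma homogP e P :
  homog e P <-> forall i j, (i + j)%N <> e -> P`_i`_j = 0.
Proof.
split=> [hP i j ne|hP i j]; last by apply: contra_neq_eq => /eqP; apply: hP.
by apply/eqP/negPn/negP => /hP.
Qed.

Lemma homog_binform e a : homog e (binform e a).
Proof. by apply/homogP => i j /eqP/negPf; rewrite coef_binform => ->. Qed.

Lemma binformK e P : homog e P -> P = binform e (fun i => P`_i`_(e - i)).
Proof.
move=> /homogP hP; apply/polyP => i; apply/polyP => j.
rewrite coef_binform; case: eqP => [<-|/hP //]; by rewrite addKn.
Qed.

Lemma eq_homog d P Q : homog d P -> homog d Q ->
  (forall i, (i <= d)%N -> P`_i`_(d - i) = Q`_i`_(d - i)) -> P = Q.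
Proof.
move=> /binformK -> /binformK -> PQ; apply: eq_bigr => i _.
by have := PQ i (ltn_ord i); rewrite !coef_binform subnKC ?eqxx -1?ltnS // => ->.
Qed.

Lemma homogD d P Q : homog d P -> homog d Q -> homog d (P + Q).
Proof.
move=> /homogP hP /homogP hQ; apply/homogP => i j ne.
by rewrite !coefD hP ?hQ ?addr0.
Qed.

Lemma homog_sum d (I : finType) (F : I -> bipoly R) :
  (forall i, homog d (F i)) -> homog d (\sum_i F i).
Proof.
move=> hF; apply/homogP => i j ne; rewrite !coef_sum big1 // => k _.
by move/homogP: (hF k) => ->.
Qed.

Lemma homogZ d c P : homog d P -> homog d (c%:P%:P * P).
Proof.
by move=> /homogP hP; apply/homogP => i j ne; rewrite coef_scaleP hP ?mulr0.
Qed.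

Lemma homogM d e P Q : homog d P -> homog e Q -> homog (d + e) (P * Q).
Proof.
move=> /homogP hP /homogP hQ; apply/homogP => i j ne.
rewrite coefM coef_sum big1 // => a _; rewrite coefM big1 // => b _.
have [ab|ab] := eqVneq (a + b)%N d; last by rewrite hP ?mul0r //; apply/eqP.
rewrite [in X in _ * X]hQ ?mulr0 // => cd; case: ne.
by rewrite -ab -cd addnACA !subnKC // -ltnS.
Qed.

Lemma homogX d P k : homog d P -> homog (d * k) (P ^+ k).
Proof.
move=> hP; elim: k => [|k IH]; last by rewrite exprS mulnS; apply: homogM.
apply/homogP => i j; rewrite muln0 expr0 coef1.
by case: i => [|i] //=; rewrite ?coef0 // coef1; case: j.
Qed.

End Forms.

Arguments binform {R}.

(** * Root counting and linear duality *)

Lemma sum_multiplicities_lt_size (F : fieldType) (I : eqType) (s : seq I)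
    (x : I -> F) (mu : I -> nat) (q : {poly F}) :
  q != 0 -> uniq s -> {in s &, injective x} ->
  (forall i, i \in s -> ('X - (x i)%:P) ^+ mu i %| q) ->
  (\sum_(i <- s) mu i < size q)%N.
Proof.
move=> q0 us xinj xq; pose P (s : seq I) := \prod_(i <- s) ('X - (x i)%:P) ^+ mu i.
have sizeP (s' : seq I) : size (P s') = (\sum_(i <- s') mu i).+1.
  rewrite /P; elim: s' => [|i s' IH]; first by rewrite !big_nil size_poly1.
  have Pm : \prod_(i <- s') ('X - (x i)%:P) ^+ mu i \is monic.
    by apply: monic_prod => j _; rewrite monic_exp ?monicXsubC.
  rewrite !big_cons size_Mmonic ?expf_neq0 ?polyXsubC_eq0 // IH.
  by rewrite size_exp_XsubC addnS.
rewrite -sizeP dvdp_leq //.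
(* Powers of distinct linear factors are coprime, so their product divides [q] once each of them
   does. *)
suff Pq s' : uniq s' -> {subset s' <= s} -> P s' %| q by apply: Pq.
elim: s' => [|i s' IH] us' ss'; first by rewrite /P big_nil dvd1p.
case/andP: us' => ns' us'.
have s's j : j \in s' -> j \in s by move=> js'; apply: ss'; rewrite inE js' orbT.
have si : i \in s by apply/ss'/mem_head.
rewrite /P big_cons Gauss_dvdp ?xq //; first exact: IH.
apply: coprimep_expl; rewrite coprimep_sym coprimep_XsubC rootE horner_prod.
rewrite prodf_seq_neq0; apply/allP => j js'; rewrite /= !horner_exp !hornerE expf_neq0 //.
by rewrite subr_eq0; apply: contra ns' => /eqP /xinj -> //; apply: s's.
Qed.

(** The columns of the cokernel of the matrix of generators are functionals killing every generator.
    If all of these are zero, the row space is everything. *)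
Lemma span_of_dual (F : fieldType) (I : finType) n (g : I -> nat -> F) :
  (forall la : nat -> F, (forall i, \sum_(j < n) la j * g i j = 0) ->
    forall j, (j < n)%N -> la j = 0) ->
  forall w : nat -> F, exists v : I -> F,
    forall j, (j < n)%N -> \sum_i v i * g i j = w j.
Proof.
move=> dual w; pose A := \matrix_(i < #|I|, j < n) g (enum_val i) j.
have A0 : cokermx A = 0.
  apply/matrixP => j k; rewrite [RHS]mxE.
  pose la i := if insub i is Some j' then cokermx A j' k else 0.
  have laE (j' : 'I_n) : la j' = cokermx A j' k by rewrite /la valK.
  rewrite -laE; apply: dual => // i.
  have /matrixP /(_ (enum_rank i) k) := mulmx_coker A; rewrite mxE [RHS]mxE => Ai.
  rewrite -[RHS]Ai; apply: eq_bigr => j' _.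
  by rewrite mxE enum_rankK laE mulrC.
have : (\row_(j < n) w j <= A)%MS by rewrite submxE A0 mulmx0.
case/submxP => D wD; exists (fun i => D 0 (enum_rank i)) => j lt_j.
have /rowP /(_ (Ordinal lt_j)) := wD; rewrite !mxE /= => ->.
rewrite (reindex (@enum_val I predT)) /=; last first.
  by apply: onW_bij; apply: enum_val_bij.
by apply: eq_bigr => i _; rewrite mxE enum_valK.
Qed.

(** * Apolarity *)

Section Functional.
Variables (R : comNzRingType) (d : nat) (la : nat -> R).

(** [la i] is the value on x^i y^(d-i); only the part of degree [d] of [P] is read. *)
Definition functional (P : bipoly R) : R := \sum_(i < d.+1) la i * P`_i`_(d - i).

Lemma functional0 : functional 0 = 0.
Proof. by rewrite /functional big1 // => i _; rewrite !coef0 mulr0. Qed.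

Lemma functionalD P Q : functional (P + Q) = functional P + functional Q.
Proof.
by rewrite /functional -big_split; apply: eq_bigr => i _; rewrite !coefD mulrDr.
Qed.

Lemma functionalZ c P : functional (c%:P%:P * P) = c * functional P.
Proof.
rewrite /functional mulr_sumr; apply: eq_bigr => i _.
by rewrite coef_scaleP mulrCA.
Qed.

Lemma functionalMn P k : functional (P *+ k) = functional P *+ k.
Proof.
by elim: k => [|k IH]; rewrite ?functional0 // !mulrS functionalD IH.
Qed.

Lemma functional_sum (I : Type) (s : seq I) (F : I -> bipoly R) :
  functional (\sum_(i <- s) F i) = \sum_(i <- s) functional (F i).
Proof. exact: (big_morph _ functionalD functional0). Qed.

Lemma functional_monomial i : (i <= d)%N ->
  functional ('X^i * 'Y ^+ (d - i)) = la i.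
Proof.
move=> le_i; have lt_i : (i < d.+1)%N by [].
rewrite /functional (bigD1 (Ordinal lt_i)) //= coef_monomial !eqxx mulr1.
rewrite big1 ?addr0 // => j nj; rewrite coef_monomial.
case: eqP => [ji|_]; last by rewrite mulr0.
by case/eqP: nj; apply: val_inj.
Qed.

(** The apolar form in an affine coordinate: its value at b is the functional at (x + b y)^d. *)
Definition apolar : {poly R} := \poly_(i < d.+1) (la (d - i) *+ 'C(d, i)).

Lemma horner_apolar b : apolar.[b] = functional (('X + b%:P%:P * 'Y) ^+ d).
Proof.
rewrite /apolar horner_poly exprDn functional_sum; apply: eq_bigr => i _.
have -> : (b%:P%:P * 'Y) ^+ i = (b ^+ i)%:P%:P * 'Y ^+ i.
  by rewrite exprMn !rmorphXn.
rewrite functionalMn mulrCA functionalZ.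
rewrite -{6}(subKn (ltnSE (ltn_ord i))) functional_monomial ?leq_subr //.
by rewrite mulrnAl mulrC.
Qed.
End Functional.

Arguments functional {R}.
Arguments apolar {R}.

Lemma homog_X (R : comNzRingType) : homog 1 ('X : bipoly R).
Proof.
apply/homogP => i j; rewrite coefX; case: eqP => [->|_ _]; last by rewrite coef0.
by rewrite coef1; case: j.
Qed.

Lemma homog_Y (R : comNzRingType) : homog 1 ('Y : bipoly R).
Proof.
apply/homogP => i j; rewrite coefC; case: i => [|i] /=; last by rewrite coef0.
by rewrite coefX; case: eqP => [->|].
Qed.

Lemma homog_linear (R : comNzRingType) (c : R) :
  homog 1 ('X + c%:P%:P * 'Y : bipoly R).
Proof. by apply: homogD (homog_X R) _; apply/homogZ/homog_Y. Qed.

Lemma homog_exp (R : comNzRingType) k (P : bipoly R) :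
  homog 1 P -> homog k (P ^+ k).
Proof. by move=> /(homogX _ 1 P k); rewrite mul1n. Qed.

(** With L = x + c y, the Taylor coefficients of the apolar polynomial at [c] are binomial multiples
    of the functional at L^(d-a) y^a. For a <= e this form is L^(d-e) times a form of degree [e], so
    the first e + 1 coefficients vanish. *)
Lemma dvd_apolar (R : numFieldType) d (la : nat -> R) e (c : R) : (e <= d)%N ->
  (forall P, homog e P ->
     functional d la (('X + c%:P%:P * 'Y) ^+ (d - e) * P) = 0) ->
  ('X - c%:P) ^+ e.+1 %| apolar d la.
Proof.
move=> le_ed laP; pose L : bipoly R := 'X + c%:P%:P * 'Y.
pose q := \poly_(a < d.+1) (functional d la (L ^+ (d - a) * 'Y ^+ a) *+ 'C(d, a)).
have qE : q = apolar d la \Po ('X + c%:P).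
  apply/eqP; rewrite -subr_eq0; apply/eqP/poly_fun_eq0 => h.
  rewrite hornerD hornerN horner_comp hornerD hornerX hornerC horner_apolar.
  apply/eqP; rewrite subr_eq0; apply/eqP.
  have -> : 'X + (h + c)%:P%:P * 'Y = L + h%:P%:P * 'Y.
    by rewrite -addrA -mulrDl -!polyCD [c + h]addrC.
  rewrite horner_poly exprDn functional_sum; apply: eq_bigr => a _.
  have -> : (h%:P%:P * 'Y) ^+ a = (h ^+ a)%:P%:P * 'Y ^+ a.
    by rewrite exprMn !rmorphXn.
  by rewrite functionalMn mulrCA functionalZ mulrnAl mulrC.
have q0 : take_poly e.+1 q = 0.
  apply/polyP => a; rewrite coef_take_poly coef0; case: ltnP => // lt_a.
  rewrite coef_poly; case: ltnP => // _.
  have -> : (d - a = (d - e) + (e - a))%N.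
    by rewrite addnBA // subnK.
  rewrite exprD -mulrA laP ?mul0rn //.
  rewrite -[X in homog X](subnK (lt_a : a <= e)%N).
  apply: homogM; first exact/homog_exp/homog_linear.
  exact/homog_exp/homog_Y.
rewrite -(comp_polyXaddC_K (apolar d la) c) -qE.
rewrite -(poly_take_drop e.+1 q) q0 add0r comp_polyM comp_Xn_poly.
exact: dvdp_mull.
Qed.

(* A linear functional killing the tangent space yields an apolar form of degree
   d with at least d + 1 zeros, counted with multiplicity; the point at infinity
   is a zero when some l_j is proportional to y. *)
Lemma functional_eq0 (R : numFieldType) d m r (l : 'I_m -> bipoly R)
    (e : 'I_r -> nat) (c : 'I_r -> R) (la : nat -> R) :
  (forall j, homog 1 (l j)) -> (forall j, l j != 0) ->
  (forall i j, i != j -> forall a : R, l i != a%:P%:P * l j) ->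
  (forall k, (e k <= d)%N) -> (m + \sum_(k < r) (e k).+1 = d.+1)%N ->
  injective c -> (forall j k, (l j)`_0`_1 != c k * (l j)`_1`_0) ->
  (forall j, functional d la (l j ^+ d) = 0) ->
  (forall k P, homog (e k) P ->
     functional d la (('X + (c k)%:P%:P * 'Y) ^+ (d - e k) * P) = 0) ->
  forall i, (i <= d)%N -> la i = 0.
Proof.
move=> hl nl npl le_ed dimE cinj lc lal lac.
pose alpha j := (l j)`_1`_0; pose beta j := (l j)`_0`_1.
(* Proportional coefficient pairs force equal indices. *)
have lE i j a : alpha i = a * alpha j -> beta i = a * beta j -> i = j.
  move=> Ea Eb; apply/eqP/negPn/negP => /npl /(_ a) /eqP; apply.
  apply: (@eq_homog R 1) => //; first exact: homogZ.
  by case=> [|[|//]] _; rewrite coef_scaleP.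
have inf_beta j : alpha j = 0 -> beta j != 0.
  move=> aj; apply: contra (nl j) => /eqP bj; apply/eqP.
  apply: (@eq_homog R 1) => //.
    by apply/homogP => i k _; rewrite !coef0.
  by case=> [|[|//]] _; rewrite !coef0.
have lL j : l j = 'X * (alpha j)%:P%:P + (beta j)%:P%:P * 'Y.
  apply: (@eq_homog R 1) => //.
    apply: homogD; last exact/homogZ/homog_Y.
    by rewrite mulrC; apply/homogZ/homog_X.
  case=> [|[|//]] _; rewrite coefD coefD mulrC !coef_scaleP !coefX !coefC /=.
    by rewrite mulr0 add0r coefX mulr1.
  by rewrite mulr1 mulr0 addr0.
pose q := apolar d la.
suff q0 : q = 0.
  move=> i le_i; have : q`_(d - i) = 0 by rewrite q0 coef0.
  rewrite coef_poly ltnS leq_subr subKn // => /eqP.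
  by rewrite mulrn_eq0 -leqn0 leqNgt bin_gt0 leq_subr => /eqP.
apply/eqP/negPn/negP => q0.
(* A form alpha x + beta y with alpha nonzero gives the root beta / alpha; [fin] discards a form at
   infinity, where alpha = 0. *)
pose x (z : 'I_m + 'I_r) := match z with inl j => beta j / alpha j | inr k => c k end.
pose mu (z : 'I_m + 'I_r) := match z with inl j => 1%N | inr k => (e k).+1 end.
pose fin (z : 'I_m + 'I_r) := if z is inl j then alpha j != 0 else true.
have := @sum_multiplicities_lt_size R _ [seq z <- index_enum _ | fin z] x mu q q0.
rewrite filter_uniq ?index_enum_uniq // => /(_ isT).
have xinj : {in [seq z <- index_enum _ | fin z] &, injective x}.
  move=> [i|i] [j|j]; rewrite !mem_filter => /andP[fi _] /andP[fj _];
    move: fi fj => /= fi fj.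
  - move=> Ex; congr inl; apply: (lE _ _ (alpha i / alpha j)).
      by rewrite divfK.
    by rewrite -[LHS](divfK fi) [_ / _]Ex mulrC mulrA mulrAC.
  - move=> Ex; case/eqP: (lc i j); rewrite -/(alpha i) -/(beta i) -Ex divfK //.
  - move=> Ex; case/eqP: (lc j i); rewrite -/(alpha j) -/(beta j) Ex divfK //.
  - by move/cinj ->.
have xdvd z : z \in [seq z <- index_enum _ | fin z] -> ('X - (x z)%:P) ^+ mu z %| q.
  rewrite mem_filter => /andP[fz _]; case: z fz => [j|k] /= fj; last first.
    by apply: dvd_apolar => //; apply: lac.
  rewrite expr1 dvdp_XsubCl rootE horner_apolar.
  have -> : 'X + (beta j / alpha j)%:P%:P * 'Y = ((alpha j)^-1)%:P%:P * l j.
    rewrite lL mulrDr mulrCA -!polyCM mulVf // mulr1 mulrA -!polyCM.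
    by rewrite [_^-1 * _]mulrC.
  by rewrite exprMn -!rmorphXn /= functionalZ lal mulr0.
move=> /(_ xinj xdvd); rewrite big_filter big_sumType /=.
move=> lt_q.
have szq : (size q <= d.+1)%N by apply: size_poly.
(* With no form at infinity, d + 1 roots already contradict [size q <= d + 1], as the root count is
   strictly below the size. *)
have [j aj|fin_all] := pickP [pred j | alpha j == 0]; last first.
  move: lt_q; rewrite (eq_bigl xpredT) => [|j]; last by have /= -> := fin_all j.
  by rewrite sum1_card card_ord dimE ltnNge szq.
(* Here [l j] is a multiple of y, so the functional kills y^d; the coefficient of degree [d] in [q]
   vanishes, which makes up for the lost root. *)
have la0 : la 0 = 0.
  have := lal j; rewrite lL (eqP aj) mulr0 add0r exprMn -!rmorphXn /= functionalZ.
  move/eqP; rewrite mulf_eq0 expf_eq0 (negPf (inf_beta _ (eqP aj))) andbF /=.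
  have := @functional_monomial R d la 0 isT.
  by rewrite subn0 mul1r rmorphXn => -> /eqP.
have {}szq : (size q <= d)%N.
  apply/leq_sizeP => i; rewrite leq_eqVlt => /orP[/eqP<-|lt_di].
    by rewrite coef_poly ltnSn subnn la0 mul0rn.
  by rewrite (leq_sizeP _ _ szq).
(* Two forms at infinity would be proportional, so exactly one is discarded. *)
have : (\sum_(j0 | alpha j0 != 0%R) 1 = m.-1)%N.
  rewrite sum1_card (eq_card (_ : _ =i predC1 j)) ?cardC1 ?card_ord // => i.
  rewrite !inE; congr (~~ _); apply/idP/eqP => [/eqP ai|->] //.
  apply: (lE _ _ (beta i / beta j)); first by rewrite ai (eqP aj) mulr0.
  by rewrite divfK // inf_beta // (eqP aj).
move=> sumE; rewrite sumE in lt_q.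
have m_gt0 : (0 < m)%N by apply: leq_ltn_trans (ltn_ord j).
have := leq_trans lt_q szq.
by rewrite -ltnS -addSn prednK // dimE ltnn.
Qed.

(** * Surjectivity of the differential *)

Lemma tangent_surjective (R : numFieldType) d m r (l : 'I_m -> bipoly R)
    (e : 'I_r -> nat) (c : 'I_r -> R) : (0 < d)%N ->
  (forall j, homog 1 (l j)) -> (forall j, l j != 0) ->
  (forall i j, i != j -> forall a : R, l i != a%:P%:P * l j) ->
  (forall k, (e k %| d)%N) -> (m + \sum_(k < r) (e k).+1 = d.+1)%N ->
  injective c -> (forall j k, (l j)`_0`_1 != c k * (l j)`_1`_0) ->
  forall w : nat -> R, exists (v : 'I_m -> R) (b : 'I_r -> nat -> R),
    \sum_j (v j)%:P%:P * l j ^+ d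
    + \sum_k (('X + (c k)%:P%:P * 'Y) ^+ (d - e k) * binform (e k) (b k))
        *+ (d %/ e k)
    = binform d w.
Proof.
move=> d_gt0 hl nl npl dvd_e dimE cinj lc w.
have le_e k : (e k <= d)%N by apply: dvdn_leq.
pose L k : bipoly R := 'X + (c k)%:P%:P * 'Y.
pose gk k (i : nat) := (L k ^+ (d - e k) * ('X^i * 'Y ^+ (e k - i))) *+ (d %/ e k).
(* To have one finite index type, each [k] gets d + 1 generators, those beyond [e k] being 0. The
   factor d / e_k in [gk] comes from differentiating a power. *)
pose gen (z : 'I_m + 'I_r * 'I_d.+1) := match z with
  | inl j => l j ^+ d
  | inr ki => if (ki.2 < (e ki.1).+1)%N then gk ki.1 ki.2 else 0
  end.
(* By duality it suffices that a functional killing all generators is zero. *)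
have [la laP|v vP] :=
  @span_of_dual R _ d.+1 (fun z i => (gen z)`_i`_(d - i)) _ w.
  apply: (@functional_eq0 R d m r l e c la) => //.
    by move=> j; apply: (laP (inl j)).
  move=> k P /binformK ->; rewrite /binform mulr_sumr functional_sum big1 // => i _.
  rewrite mulrCA functionalZ.
  have lt_i : (i < d.+1)%N by rewrite (leq_trans (ltn_ord i)) ?ltnS.
  have := laP (inr (k, Ordinal lt_i)); rewrite /= ltn_ord => /eqP.
  rewrite -/(functional d la _) functionalMn mulrn_eq0 => /orP[|/eqP->].
    by rewrite eqn0Ngt divn_gt0 ?le_e ?(dvdn_gt0 d_gt0).
  by rewrite mulr0.
exists (fun j => v (inl j)), (fun k i => v (inr (k, inord i))).
apply: (@eq_homog R d); last 1 first.
- move=> i le_i; rewrite coef_binform subnKC // eqxx -vP // big_sumType /=.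
  rewrite !coefD !coef_sum; congr (_ + _).
    by apply: eq_bigr => j _; rewrite coef_scaleP.
  pose G k (a : 'I_d.+1) :=
    v (inr (k, a)) * (if (a < (e k).+1)%N then gk k a else 0)`_i`_(d - i).
  rewrite [RHS](eq_bigr (fun ka => G ka.1 ka.2)) => [|[k a] _ //].
  rewrite -(pair_bigA _ G) /=.
  apply: eq_bigr => k _.
  rewrite /binform mulr_sumr -sumrMnl (big_ord_widen d.+1 (fun a =>
    L k ^+ (d - e k) * ((v (inr (k, inord a)))%:P%:P * ('X^a * 'Y ^+ (e k - a)))
      *+ (d %/ e k))) ?ltnS // !coef_sum big_mkcond; apply: eq_bigr => a _.
  rewrite /G; case: ifP => _; last by rewrite !coef0 mulr0.
  by rewrite mulrCA -mulrnAr coef_scaleP inord_val.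
- apply: homogD; apply: homog_sum => j.
    by apply/homogZ/homog_exp.
  have /homogP hj : homog d (('X + (c j)%:P%:P * 'Y) ^+ (d - e j)
      * binform (e j) (fun i => v (inr (j, inord i)))).
    rewrite -[X in homog X](subnK (le_e j)).
    by apply: homogM; [apply/homog_exp/homog_linear | apply: homog_binform].
  by apply/homogP => a b ne; rewrite !coefMn hj ?mul0rn.
- exact: homog_binform.
Qed.

(** * Choice of points and curves of forms *)

Lemma exists_avoiding (R : numFieldType) (bad : seq R) r :
  exists2 c : 'I_r -> R, injective c & forall k, c k \notin bad.
Proof.
(* Of these [size bad + r] distinct naturals at most [size bad] are excluded. *)
pose s : seq R := [seq i%:R | i <- iota 0 (size bad + r)].
have us : uniq s.
  by rewrite map_inj_uniq ?iota_uniq // => i j /eqP; rewrite eqr_nat => /eqP.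
pose good := [seq x <- s | x \notin bad].
have le_r : (r <= size good)%N.
  rewrite size_filter -(leq_add2l (count (mem bad) s)) count_predC size_map size_iota.
  rewrite leq_add2r -size_filter uniq_leq_size ?filter_uniq // => x.
  by rewrite mem_filter => /andP[].
have lt_k (k : 'I_r) : (k < size good)%N by apply: leq_trans (ltn_ord k) le_r.
exists (fun k : 'I_r => good`_k) => [i j /eqP|k].
  by rewrite nth_uniq ?filter_uniq // => /eqP/val_inj.
by have := mem_nth 0 (lt_k k); rewrite mem_filter => /andP[].
Qed.

(** For a family of forms depending polynomially on a parameter, this is the coefficient of x^i y^j
    as a polynomial in that parameter. *)
Definition coef_along {R : comNzRingType} (Phi : {poly bipoly R}) i j : {poly R} :=
  \poly_(k < size Phi) (Phi`_k)`_i`_j.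

Lemma coef_coef_along (R : comNzRingType) (Phi : {poly bipoly R}) i j k :
  (coef_along Phi i j)`_k = (Phi`_k)`_i`_j.
Proof.
by rewrite coef_poly; case: ltnP => // le_k; rewrite (nth_default 0 le_k) !coef0.
Qed.

Lemma horner_coef_along (R : comNzRingType) (Phi : {poly bipoly R}) i j a :
  (coef_along Phi i j).[a] = (Phi.[a%:P%:P])`_i`_j.
Proof.
rewrite horner_poly horner_coef !coef_sum; apply: eq_bigr => k _.
by rewrite mulrC [in RHS]mulrC -!rmorphXn coef_scaleP.
Qed.

Lemma eq_binform (R : comNzRingType) e (a b : nat -> R) :
  (forall i, (i <= e)%N -> a i = b i) -> binform e a = binform e b.
Proof. by move=> ab; apply: eq_bigr => i _; rewrite ab // -ltnS. Qed.

(** Read off the derivative at 0; this is the differential of the k-th power map at [a]. *)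
Lemma coef1_exp_linear (A : comNzRingType) (a b : A) k :
  ((a%:P + b *: 'X) ^+ k)`_1 = (a ^+ k.-1 * b) *+ k.
Proof.
have := coef_deriv ((a%:P + b *: 'X) ^+ k) 0; rewrite mulr1n => <-.
rewrite deriv_exp derivD derivC derivZ derivX add0r coefMn -scalerAl mul1r coefZ.
by rewrite -horner_coef0 horner_exp !hornerE mulrC.
Qed.

(** Layout of the variables: the point, the [m] scalars, then [r] coefficient blocks of uniform
    length [n], so that division by [n] decodes a position. *)
Lemma seq_of_blocks (R : nzRingType) n m r (x : seq R) (t : 'I_m -> R)
    (a : 'I_r -> nat -> R) : size x = n ->
  exists z : seq R, [/\ size z = (n + (m + r * n))%N, take n z = x,
    forall j : 'I_m, z`_(n + j) = t j &
    forall (k : 'I_r) i, (i < n)%N -> z`_(n + (m + (k * n + i))) = a k i].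
Proof.
move=> sx.
pose ts := mkseq (fun j => oapp t 0 (insub j)) m.
pose us := mkseq (fun q => oapp a (fun=> 0) (insub (q %/ n)%N) (q %% n)%N) (r * n).
exists (x ++ ts ++ us); split.
- by rewrite !size_cat !size_mkseq sx.
- by rewrite take_size_cat.
- move=> j; rewrite nth_cat sx ltnNge leq_addr /= addKn nth_cat size_mkseq ltn_ord.
  by rewrite nth_mkseq // valK.
move=> k i lt_in; rewrite nth_cat sx ltnNge leq_addr /= addKn nth_cat size_mkseq.
rewrite ltnNge leq_addr /= addKn nth_mkseq.
  rewrite divnMDl ?(leq_ltn_trans _ lt_in) // divn_small // addn0 valK /=.
  by rewrite modnMDl modn_small.
apply: leq_trans (leq_mul (ltn_ord k) (leqnn n)).
by rewrite mulSn addnC ltn_add2r.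
Qed.

(** * The parametrization and its dominance *)

Theorem theorem1p6 (R : numClosedFieldType) (d m : nat)
  (l : 'I_m -> {poly {poly R}}) (r : nat) (e : 'I_r -> nat) :
  (1 <= d)%N ->
  (forall j, homog 1 (l j)) ->
  (forall j, l j != 0) ->
  (forall i j : 'I_m, i != j -> forall c : R, l i != c%:P%:P * l j) ->
  (forall k, 0 < e k)%N ->
  (forall k, e k %| d)%N ->
  (forall k, e k < d)%N ->
  (forall k1 k2 : 'I_r, k1 <= k2 -> e k2 <= e k1)%N ->
  (m + \sum_(k < r) (e k).+1 = d.+1)%N ->
  general_form d (fun p =>
    exists (t : 'I_m -> R) (f : 'I_r -> {poly {poly R}}),
      (forall k, homog (e k) (f k)) /\
      p = \sum_(j < m) (t j)%:P%:P * l j ^+ d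
          + \sum_(k < r) f k ^+ (d %/ e k)%N).
Proof.
move=> d_gt0 hl nl npl e_gt0 dvd_e lt_e _ dimE.
pose n := d.+1.
pose F (t : 'I_m -> R) (a : 'I_r -> nat -> R) : bipoly R :=
  \sum_(j < m) (t j)%:P%:P * l j ^+ d
  + \sum_(k < r) binform (e k) (a k) ^+ (d %/ e k)%N.
have hF t a : homog d (F t a).
  apply: homogD; apply: homog_sum => j; first exact/homogZ/homog_exp.
  by rewrite -{1}(divnK (dvd_e j)) mulnC; apply/homogX/homog_binform.
pose Fz (z : seq R) := F (fun j => z`_(n + j))
  (fun k i => z`_(n + (m + (k * n + i)))).
have FzP i : ring_fun (fun z => (Fz z)`_i`_(d - i)).
  have : bipoly_fun Fz; last by apply.
  rewrite /Fz /F; apply: bipoly_funD; apply: bipoly_fun_sum => j.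
    apply: bipoly_funM; last exact: bipoly_fun_const.
    exact/bipoly_funC/ring_fun_nth.
  apply/bipoly_fun_exp/bipoly_fun_sum => a.
  apply: bipoly_funM; last exact: bipoly_fun_const.
  exact/bipoly_funC/ring_fun_nth.
have [f [rf fF Ff]] := @image_formula R n (m + r * n) _ FzP.
(* [f] defines the image of the parametrization in coordinates. *)
suff [U [oU nU US]] : contains_open n (fun x => GRing.holds x f).
  exists U; split=> // p hp /US; rewrite size_mkseq => /(_ erefl) /fF[z zP].
  exists (fun j => z`_(n + j)), (fun k => binform (e k)
    (fun i => z`_(n + (m + (k * n + i))))).
  split; first by move=> k; apply: homog_binform.
  apply: (@eq_homog R d p (Fz z)) => // [|i le_i]; first exact: hF.
  by rewrite zP // nth_mkseq.
apply: definable_contains_open => // G rG GS.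
(* The slopes of the [l j]. A multiple of y contributes 0 by the convention for division; for it
   [lc] follows from [l j] being nonzero. *)
pose bad := [seq (l j)`_0`_1 / (l j)`_1`_0 | j <- enum 'I_m].
have [c cinj cbad] := @exists_avoiding R bad r.
have lc j k : (l j)`_0`_1 != c k * (l j)`_1`_0.
  have [a0|a0] := eqVneq ((l j)`_1`_0) 0.
    rewrite a0 mulr0; apply: contra (nl j) => /eqP b0.
    apply/eqP/(@eq_homog R 1) => // [|[|[|//]] _]; rewrite ?coef0 //.
    by apply/homogP => i1 i2 _; rewrite !coef0.
  apply: contra (cbad k) => /eqP Eb; apply/mapP; exists j; first exact: mem_enum.
  by rewrite Eb mulfK.
pose L k : bipoly R := 'X + (c k)%:P%:P * 'Y.
pose al k i := (L k ^+ e k)`_i`_(e k - i).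
have alE k : binform (e k) (al k) = L k ^+ e k.
  by rewrite -binformK //; apply/homog_exp/homog_linear.
(* The image of the base point t = 0, f_k = L_k^(e_k). *)
pose y0 i := (F (fun=> 0) al)`_i`_(d - i).
apply: (@zariski_dense_of_curves R n
  (fun x => size x = n /\ GRing.holds x f) y0) => // [w|x [sx fx]]; last exact: GS.
have [v [b vbE]] :=
  @tangent_surjective R d m r l e c d_gt0 hl nl npl dvd_e dimE cinj lc w.
(* The image of the line through the base point in the direction (v, b), which the differential
   sends to [w]. *)
pose Phi : {poly bipoly R} := \sum_j ((v j)%:P%:P * l j ^+ d) *: 'X
  + \sum_k ((L k ^+ e k)%:P + binform (e k) (b k) *: 'X) ^+ (d %/ e k).
have PhiE a : Phi.[a%:P%:P] = F (fun j => a * v j) (fun k i => al k i + a * b k i).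
  rewrite /Phi hornerD !horner_sum; congr (_ + _); apply: eq_bigr => j _.
    by rewrite hornerZ hornerX mulrC mulrA -!polyCM.
  rewrite horner_exp hornerD hornerC hornerZ hornerX -alE; congr (_ ^+ _).
  rewrite /binform mulr_suml -big_split; apply: eq_bigr => i _ /=.
  by rewrite !polyCD mulrDl !polyCM mulrAC [a%:P%:P * _]mulrC.
exists (fun i => coef_along Phi i (d - i)); split=> [i lt_i|i lt_i|a].
- rewrite -horner_coef0 horner_coef_along PhiE /y0.
  suff -> : F (fun j => 0 * v j) (fun k i => al k i + 0 * b k i) = F (fun=> 0) al.
    by [].
  congr (_ + _); apply: eq_bigr => k _; first by rewrite mul0r.
  by congr (_ ^+ _); apply: eq_binform => j _; rewrite mul0r addr0.
- rewrite coef_coef_along.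
  have -> : Phi`_1 = binform d w.
    rewrite -vbE coefD !coef_sum; congr (_ + _); apply: eq_bigr => k _.
      by rewrite coefZ coefX mulr1.
    rewrite coef1_exp_linear -exprM; congr (_ ^+ _ * _ *+ _).
    by rewrite -subn1 mulnBr muln1 mulnC divnK.
  by rewrite coef_binform subnKC ?eqxx.
split; first by rewrite size_mkseq.
set x := mkseq _ _; have sx : size x = n by rewrite size_mkseq.
(* The parameters of the curve at [a] serve as witnesses for the existential quantifiers of [f]. *)
have [z [sz zx zt za]] := @seq_of_blocks R n m r x (fun j => a * v j)
  (fun k i => al k i + a * b k i) sx.
rewrite -zx; apply: Ff => // i lt_i.
rewrite -(nth_take 0 lt_i z) zx nth_mkseq // horner_coef_along PhiE.
suff -> : Fz z = F (fun j => a * v j) (fun k i => al k i + a * b k i) by [].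
congr (_ + _); apply: eq_bigr => k _; first by rewrite zt.
congr (_ ^+ _); apply: eq_binform => j le_j; apply: za.
by rewrite ltnS (leq_trans le_j) // ltnW.
Qed.
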